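(* There exists a finite constant $C>0$ such that for each positive integer $m$ we have \[ d_{\mathcal{W}}\bigl(\mathcal{L}(W_m),\nu\bigr)\leq\frac{C}{m}, \] where $W_m$ is the relative time spent positive up to time $2m$ by the symmetric simple random walk on $\mathbb{Z}$, $\nu$ is the arcsine distribution on $[0,1]$, and $d_{\mathcal{W}}$ is the Wasserstein distance.
   Context: Let $\varepsilon_1,\varepsilon_2,\ldots$ be i.i.d. random variables with $P(\varepsilon_1=1)=P(\varepsilon_1=-1)=\frac12$, and let $S_k:=\sum_{j=1}^k\varepsilon_j$ for $k\geq 0$ (so $S_0=0$). For $j\geq1$ let $X_j:=1_{\{S_{j-1}\geq0,\,S_j\geq0\}}$. For a positive integer $m$ let $T_m:=\sum_{j=1}^{2m}X_j$ and $W_m:=\frac{1}{2m}T_m$. $\mathcal{L}(W_m)$ denotes the distribution of $W_m$. The arcsine distribution $\nu$ on $[0,1]$ is the probability measure on $\mathbb{R}$ with Lebesgue density $q(x)=\frac{1}{\pi\sqrt{x(1-x)}}1_{(0,1)}(x)$. For two probability measures $\mu_1,\mu_2$ on the Borel sets of $\mathbb{R}$ with existing first moments, the Wasserstein distance is \[ d_{\mathcal{W}}(\mu_1,\mu_2):=\sup_{h\in\mathrm{Lip}(1)}\Bigl|\int_{\mathbb{R}} h\,d\mu_1-\int_{\mathbb{R}} h\,d\mu_2\Bigr|, \] where $\mathrm{Lip}(1)$ is the class of all Lipschitz-continuous functions $h:\mathbb{R}\to\mathbb{R}$ with Lipschitz constant at most $1$. *)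

(* Defs.v *)
From HB Require Import structures.
From mathcomp Require Import all_boot all_order all_algebra.
From mathcomp Require Import finmap.
From mathcomp Require Import all_classical all_reals all_analysis measurable_realfun.
From mathcomp Require Import ring lra.

Set Implicit Arguments.
Unset Strict Implicit.
Unset Printing Implicit Defensive.

Import Order.TTheory GRing.Theory Num.Theory.
Import numFieldNormedType.Exports.

Local Open Scope classical_set_scope.
Local Open Scope ring_scope.

Section arcsine_distribution.
Context {R : realType}.
Local Notation mu := (@lebesgue_measure R).

Definition arcsine_pdf (x : R) : R :=
  (pi * Num.sqrt (x * (1 - x)))^-1 * \1_(`]0, 1[ : set R) x.

Definition arcsine_prob : set (measurableTypeR R) -> \bar R :=
  fun A => (\int[mu]_(x in A) (arcsine_pdf x)%:E)%E.

Lemma arcsine_pdf_ge0 x : 0 <= arcsine_pdf x.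
Proof. by rewrite mulr_ge0// invr_ge0 mulr_ge0// ?pi_ge0 ?sqrtr_ge0. Qed.

Lemma continuous_arcsine_pdf0 (x : R) : 0 < x < 1 ->
  {for x, continuous (fun x : R => (pi * Num.sqrt (x * (1 - x)))^-1)}.
Proof.
move=> /andP[x0 x1]; apply: cvgV.
  by rewrite mulf_neq0 ?gt_eqF ?pi_gt0// sqrtr_gt0 mulr_gt0// subr_gt0.
apply: cvgM; first exact: cvg_cst.
apply: (cvg_comp _ Num.sqrt); last exact: sqrt_continuous.
by apply: cvgM; [exact: cvg_id|apply: cvgB; [exact: cvg_cst|exact: cvg_id]].
Qed.

Lemma measurable_arcsine_pdf : measurable_fun [set: R] arcsine_pdf.
Proof.
have -> : arcsine_pdf =
    (fun x : R => (pi * Num.sqrt (x * (1 - x)))^-1) \_ (`]0, 1[ : set R).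
  apply/funext => x; rewrite /arcsine_pdf patchE indicE.
  by case: ifPn => _; rewrite ?mulr1 ?mulr0.
apply/(measurable_restrictT _ _).1 => //.
apply: open_continuous_measurable_fun => // x.
by rewrite inE/= in_itv/= => /continuous_arcsine_pdf0.
Qed.

Lemma is_derive_arcsine (x : R) : 0 < x < 1 ->
  is_derive x 1 (fun x : R => asin (2 * x - 1) / pi)
    (pi * Num.sqrt (x * (1 - x)))^-1.
Proof.
move=> /andP[x0 x1].
have y1 : -1 < 2 * x - 1 < 1 by apply/andP; split; lra.
have dg : is_derive x 1 (fun x : R => 2 * x - 1) 2.
  rewrite (_ : (fun x : R => _) = (2 *: id) - cst (1 : R)); last by [].
  by apply: is_derive_eq; rewrite /GRing.scale/=; ring.
have da := is_derive1_asin y1.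
have -> : (fun x : R => asin (2 * x - 1) / pi) =
    pi^-1 *: (asin \o (fun x : R => 2 * x - 1)).
  by apply/funext => z; rewrite /= [LHS]mulrC.
apply: is_derive_eq.
have -> : 1 - (2 * x - 1) ^+ 2 = 2 ^+ 2 * (x * (1 - x)) by ring.
rewrite sqrtrM ?sqr_ge0// sqrtr_sqr ger0_norm//.
have s0 : Num.sqrt (x * (1 - x)) != 0.
  by rewrite gt_eqF// sqrtr_gt0 mulr_gt0// subr_gt0.
have p0 : pi != 0 :> R by rewrite gt_eqF ?pi_gt0.
rewrite /GRing.scale/=.
move: (Num.sqrt _) (pi : R) s0 p0 => s p s0 p0.
by field; rewrite s0 p0.
Qed.

Let angle (n : nat) : R := pi / 2 - n.+2%:R^-1.

Let angle_bounds n : 0 < angle n < pi / 2.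
Proof.
have pi2 := @pi_ge2 R.
have : (n.+2%:R^-1 : R) < 1 by rewrite invf_lt1// ltr1n.
have : 0 < (n.+2%:R^-1 : R) by rewrite invr_gt0.
rewrite /angle; move: (n.+2%:R^-1 : R) (pi : R) pi2 => k p p2 k0 k1.
by apply/andP; split; lra.
Qed.

Let angleP n : angle n \in `[(- (pi / 2)), (pi / 2 : R)].
Proof.
have := angle_bounds n; rewrite in_itv/= => /andP[? ?].
by apply/andP; split; lra.
Qed.

Let sin_angle n : 0 < sin (angle n) < 1.
Proof.
have /andP[a0 a1] := angle_bounds n.
have p0 : 0 < pi :> R := pi_gt0 R.
rewrite -[X in X < _ < _](@sin0 R) -[X in _ < _ < X](@sin_pihalf R).
rewrite !ltr_sin ?a0//; rewrite in_itv/=; apply/andP; split; lra.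
Qed.

Let itv n : set R := `[((1 - sin (angle n)) / 2), ((1 + sin (angle n)) / 2)].

Let integral_itv n :
  (\int[mu]_(x in itv n) (arcsine_pdf x)%:E = (angle n *+ 2 / pi)%:E)%E.
Proof.
have /andP[s0 s1] := sin_angle n.
have sub x : (1 - sin (angle n)) / 2 <= x <= (1 + sin (angle n)) / 2 ->
    0 < x < 1.
  by move=> /andP[? ?]; apply/andP; split; lra.
pose f (x : R) := (pi * Num.sqrt (x * (1 - x)))^-1.
pose F (x : R) := asin (2 * x - 1) / pi.
transitivity (\int[mu]_(x in itv n) (f x)%:E)%E.
  apply: eq_integral => x; rewrite inE /itv/= in_itv/= => /sub x01.
  by rewrite /arcsine_pdf indicE mem_set ?mulr1//= in_itv.
have dF x : 0 < x < 1 -> {for x, continuous F}.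
  move=> /is_derive_arcsine[dx _].
  exact/differentiable_continuous/derivable1_diffP.
rewrite /itv (@continuous_FTC2 _ f F); [|lra| | |].
- rewrite -EFinB /F.
  have -> : 2 * ((1 + sin (angle n)) / 2) - 1 = sin (angle n) by field.
  have -> : 2 * ((1 - sin (angle n)) / 2) - 1 = sin (- angle n).
    by rewrite sinN; field.
  rewrite !sinK//; last first.
    by have := angleP n; rewrite !in_itv/= => /andP[? ?]; apply/andP; split; lra.
  by rewrite -mulrBl opprK.
- apply: continuous_in_subspaceT => x; rewrite inE/= in_itv/= => /sub.
  exact: continuous_arcsine_pdf0.
- split.
  + move=> x; rewrite in_itv/= => /andP[/ltW ? /ltW ?].
    by have [] := @is_derive_arcsine x (sub _ _); [apply/andP|].
  + by apply: cvg_at_right_filter; apply: dF; apply: sub; rewrite lexx/=; lra.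
  + by apply: cvg_at_left_filter; apply: dF; apply: sub; rewrite lexx andbT; lra.
- move=> x; rewrite in_itv/= => /andP[/ltW ? /ltW ?].
  rewrite derive1E; have /is_derive_arcsine dx : 0 < x < 1.
    by apply: sub; apply/andP.
  by rewrite derive_val.
Qed.

Let bigcup_itv : \bigcup_n itv n = `]0, 1[%classic.
Proof.
apply/seteqP; split => [x [n _]|x]/=; rewrite /itv/= !in_itv/=.
  have /andP[? ?] := sin_angle n.
  by move=> /andP[? ?]; apply/andP; split; lra.
move=> /andP[x0 x1].
have y1 : -1 < 2 * x - 1 < 1 by apply/andP; split; lra.
have y1w : -1 <= 2 * x - 1 <= 1 by apply/andP; split; lra.
have aN : - (pi / 2) < asin (2 * x - 1).
  by apply: asin_gtNpi2; apply/andP; split; lra.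
have a1 : asin (2 * x - 1) < pi / 2.
  by apply: asin_ltpi2; apply/andP; split; lra.
pose e := pi / 2 - `|asin (2 * x - 1)|.
have e0 : 0 < e by rewrite subr_gt0 ltr_norml aN a1.
have [n ne] : exists n : nat, n.+2%:R^-1 < e.
  have [n _ nP] := near_infty_natSinv_lt (PosNum e0).
  exists n; have /= := nP n (leqnn n); apply: lt_trans.
  by rewrite ltf_pV2 ?posrE// ltr_nat.
have /andP[b1 b2] : - angle n < asin (2 * x - 1) < angle n.
  by rewrite -ltr_norml /angle ltrBrDr -ltrBrDl.
exists n => //; rewrite /itv/= in_itv/=.
have asiny : sin (asin (2 * x - 1)) = 2 * x - 1.
  by rewrite asinK// in_itv.
have ain : asin (2 * x - 1) \in `[(- (pi / 2)), (pi / 2 : R)].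
  by rewrite in_itv/= !ltW.
have nin : - angle n \in `[(- (pi / 2)), (pi / 2 : R)].
  by have := angleP n; rewrite !in_itv/= => /andP[? ?]; apply/andP; split; lra.
move: b1; rewrite -ltr_sin// asiny sinN => b1.
move: b2; rewrite -ltr_sin// asiny => b2.
by apply/andP; split; lra.
Qed.

Let nondecreasing_itv : nondecreasing_seq itv.
Proof.
move=> m n mn; apply/subsetPset => x; rewrite /itv/= !in_itv/=.
have : sin (angle m) <= sin (angle n).
  rewrite leNgt ltr_sin// -leNgt lerB// lef_pV2 ?posrE//.
  by rewrite ler_nat ltnS.
by move=> ? /andP[? ?]; apply/andP; split; lra.
Qed.

Lemma integral_arcsine_pdf : (\int[mu]_x (arcsine_pdf x)%:E = 1)%E.
Proof.
have mf D : measurable_fun D (EFin \o arcsine_pdf).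
  apply/measurable_EFinP; apply: measurable_funTS.
  exact: measurable_arcsine_pdf.
transitivity (\int[mu]_(x in `]0%R, 1%R[) (arcsine_pdf x)%:E)%E.
  rewrite [RHS]integral_mkcond; apply: eq_integral => x _.
  rewrite patchE; case: ifPn => [//|]; rewrite notin_setE => x01.
  by rewrite /arcsine_pdf indicE memNset// mulr0.
rewrite -bigcup_itv.
have := @ge0_nondecreasing_set_cvg_integral _ (measurableTypeR R) R itv (EFin \o arcsine_pdf) mu
  nondecreasing_itv (fun=> measurable_itv _) (fun=> mf _)
  (fun _ x _ => arcsine_pdf_ge0 x).
move/cvg_lim => <-//.
under eq_fun do rewrite /= integral_itv.
apply/cvg_lim => //; apply: cvg_EFin; first exact: nearW.
rewrite [X in X @ _ --> _](_ : _ = fun n => 1 - 2 / pi * n.+2%:R^-1); last first.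
  apply/funext => n; rewrite /= /angle mulr2n.
  have : pi != 0 :> R by rewrite gt_eqF ?pi_gt0.
  by move: (pi : R) (n.+2%:R^-1 : R) => p k p0; field.
rewrite -[X in _ --> X]subr0; apply: cvgB; first exact: cvg_cst.
rewrite -(mulr0 (2 / pi)); apply: cvgM; first exact: cvg_cst.
have := @cvg_harmonic R; rewrite -(cvg_shiftn 1).
by under eq_fun do rewrite /= addn1.
Qed.

Let arcsine0 : arcsine_prob set0 = 0%E.
Proof. by rewrite /arcsine_prob integral_set0. Qed.

Let arcsine_ge0 A : (0 <= arcsine_prob A)%E.
Proof. by apply: integral_ge0 => x _; rewrite lee_fin arcsine_pdf_ge0. Qed.

Let arcsine_sigma_additive : semi_sigma_additive arcsine_prob.
Proof.
move=> /= A mA tA mUA; rewrite /arcsine_prob ge0_integral_bigcup//=.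
- apply: is_cvg_ereal_nneg_natsum_cond => n _ _.
  by apply: integral_ge0 => x _; rewrite lee_fin arcsine_pdf_ge0.
- by apply/measurable_EFinP; apply: measurable_funTS; exact: measurable_arcsine_pdf.
- by move=> x _; rewrite lee_fin arcsine_pdf_ge0.
Qed.

HB.instance Definition _ := isMeasure.Build _ _ _
  arcsine_prob arcsine0 arcsine_ge0 arcsine_sigma_additive.

Let arcsine_setT : arcsine_prob [set: _] = 1%E.
Proof. exact: integral_arcsine_pdf. Qed.

HB.instance Definition _ :=
  @Measure_isProbability.Build _ _ R arcsine_prob arcsine_setT.

End arcsine_distribution.

(* For probability measures with finite first moments every Lipschitz function
   is integrable, so the difference below is a difference of real numbers. *)
Definition wasserstein {R : realType}
    (mu1 mu2 : probability (measurableTypeR R) R) : \bar R :=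
  ereal_sup [set `| \int[mu1]_x (h x)%:E - \int[mu2]_x (h x)%:E |%E
            | h in [set h : R -> R | 1.-lipschitz (h : R^o -> R^o)]].

Definition mutually_independent {d d' : measure_display}
    {T : measurableType d} {T' : measurableType d'} {R : realType}
    (P : probability T R) {I : choiceType} (X : I -> {RV P >-> T'}) : Prop :=
  forall (J : {fset I}) (B : I -> set T'), (forall i, measurable (B i)) ->
    P (\bigcap_(i in [set` J]) (X i @^-1` B i)) =
    (\prod_(i <- J) P (X i @^-1` B i))%E.

(* [eps j] is the step from time [j] to time [j.+1], i.e. the sequence of steps
   is indexed from 0. *)
Definition iid_rademacher {d : measure_display} {T : measurableType d}
    {R : realType} (P : probability T R) (eps : nat -> {RV P >-> R}) : Prop :=
  mutually_independent eps /\
  forall j, P [set w | eps j w = 1] = (2^-1)%:E /\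
            P [set w | eps j w = -1] = (2^-1)%:E.

Section random_walk.
Context {d : measure_display} {T : measurableType d} {R : realType}
  {P : probability T R}.
Variable eps : nat -> {RV P >-> R}.

Definition walk (k : nat) (w : T) : R := \sum_(j < k) eps j w.

(* Only meaningful for [0 < j]. *)
Definition step_nonneg (j : nat) : T -> R :=
  \1_[set w | 0 <= walk j.-1 w /\ 0 <= walk j w].

Definition time_nonneg (m : nat) (w : T) : R :=
  \sum_(1 <= j < (2 * m).+1) step_nonneg j w.

(* The codomain is [measurableTypeR R], the copy of [R] that carries
   [lebesgue_measure]; its sigma-algebra is the one of [R], under another
   display. *)
Definition relative_time_nonneg (m : nat) (w : T) : measurableTypeR R :=
  (2 * m)%:R^-1 * time_nonneg m w.

Lemma measurable_walk k : measurable_fun setT (walk k).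
Proof. exact: measurable_sum. Qed.

Lemma measurable_step_nonneg j : measurable_fun setT (step_nonneg j).
Proof.
apply: measurable_indic.
have mS k : measurable [set w | 0 <= walk k w].
  rewrite -[X in measurable X]setTI.
  rewrite (_ : [set w | _] = walk k @^-1` `[0, +oo[).
    by apply: measurable_walk => //; exact: measurable_itv.
  by apply/seteqP; split => w /=; rewrite in_itv/= andbT.
exact: measurableI (mS _) (mS _).
Qed.

Lemma measurable_relative_time_nonneg m :
  measurable_fun setT (relative_time_nonneg m).
Proof.
have mW : measurable_fun setT (relative_time_nonneg m : T -> R).
  apply: measurable_funM => //; apply: measurable_sum => j.
  exact: measurable_step_nonneg.
exact: mW.
Qed.

HB.instance Definition _ (m : nat) := isMeasurableFun.Build _ _ _ _
  (relative_time_nonneg m) (measurable_relative_time_nonneg m).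

End random_walk.

(* Main.v *)
(* With u_k = C(2k, k) / 4^k, the number of nonnegative steps among 2m is 2k with
   probability u_k u_(m-k); this follows by induction on the number of steps from
   a closed formula for walks started at any height.  Let F_m be the cumulative
   sums of these weights and F(x) = asin(2x - 1) / pi + 1/2 the arcsine
   distribution function.  A Polya urn recursion computes F_(n+1)(k) - F_n(k)
   exactly; with Wallis' inequality pi k u_k^2 <= 1 and the mean value theorem it
   shows that F((k+1)/n) - F_n(k) decreases in n.  This difference tends to 0, so
   F_m(k) <= F((k+1)/m), and by symmetry F(k/m) <= F_m(k).  Hence the monotone
   coupling moves no mass by more than 1/m, and C = 1 works. *)

Require Import Defs.
From mathcomp Require Import all_boot all_order all_algebra.
From mathcomp Require Import finmap.
From mathcomp Require Import all_classical all_reals all_analysis.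
From mathcomp Require Import measurable_realfun ring lra zify.

Import Order.TTheory GRing.Theory Num.Theory.
Import numFieldNormedType.Exports.

Local Open Scope classical_set_scope.
Local Open Scope ring_scope.

(** * Discrete arcsine weights *)

Section discrete_arcsine.
Context {R : realFieldType}.

(** The probability that the walk is at 0 at time 2k. *)
Definition central_prob (k : nat) : R := 'C(2 * k, k)%:R / 4 ^+ k.

(** The subtraction truncates: for [k] above [m] the value is [central_prob k], positive but without
    probabilistic meaning. *)
Definition arcsine_weight (m k : nat) : R :=
  central_prob k * central_prob (m - k).

Definition arcsine_cum (m k : nat) : R :=
  \sum_(j < k.+1) arcsine_weight m j.

Lemma central_prob0 : central_prob 0 = 1.
Proof. by rewrite /central_prob bin0 expr0 divr1. Qed.

Lemma central_prob_gt0 k : 0 < central_prob k.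
Proof.
by rewrite divr_gt0 ?exprn_gt0// ltr0n bin_gt0 leq_pmull.
Qed.

(** The diagonal identity for binomials, used on both sides of the symmetry of row 2k + 1, gives (k
    + 1) C(2k + 2, k + 1) = 2 (2k + 1) C(2k, k). *)
Lemma central_probS k :
  central_prob k.+1 = central_prob k * (k%:R + 2^-1) / k.+1%:R.
Proof.
have k1 : (k.+1%:R : R) != 0 by rewrite pnatr_eq0.
have h1 : (k.+1%:R * 'C(2 * k.+1, k.+1)%:R : R) =
    2 * (2 * k%:R + 1) * 'C(2 * k, k)%:R.
  have e1 : (k.+1 * 'C(2 * k.+1, k.+1) = 2 * k.+1 * 'C((2 * k).+1, k))%N.
    have := mul_bin_diag (2 * k.+1) k.
    by rewrite (_ : (2 * k.+1).-1 = (2 * k).+1)%N; last lia.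
  have e2 : (k.+1 * 'C((2 * k).+1, k) = (2 * k).+1 * 'C(2 * k, k))%N.
    have := mul_bin_diag (2 * k).+1 k; rewrite [_.-1]/=.
    have := @bin_sub (2 * k).+1 k.
    rewrite (_ : (2 * k).+1 - k = k.+1)%N; last lia.
    by move=> ->; [move=> -> //|lia].
  have e : (k.+1 * 'C(2 * k.+1, k.+1) = 2 * (2 * k + 1) * 'C(2 * k, k))%N.
    by rewrite e1; nia.
  by rewrite -natrM e !natrM natrD natrM.
rewrite /central_prob.
have -> : ('C(2 * k.+1, k.+1)%:R : R) =
   2 * (2 * k%:R + 1) * 'C(2 * k, k)%:R / k.+1%:R.
  by rewrite -h1 mulrC mulKf.
have -> : (4 : R) ^+ k.+1 = 4 * 4 ^+ k by rewrite exprS.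
have : (4 : R) ^+ k != 0 by rewrite expf_neq0 ?pnatr_eq0.
move: (4 ^+ k) => x x0.
by field; rewrite x0 nat1r k1.
Qed.

Lemma arcsine_weight_gt0 m k : 0 < arcsine_weight m k.
Proof. by rewrite mulr_gt0 ?central_prob_gt0. Qed.

Lemma arcsine_weight_sym m k : (k <= m)%N ->
  arcsine_weight m (m - k) = arcsine_weight m k.
Proof. by move=> km; rewrite /arcsine_weight subKn// mulrC. Qed.

Lemma arcsine_cumSr m k :
  arcsine_cum m k.+1 = arcsine_cum m k + arcsine_weight m k.+1.
Proof. by rewrite /arcsine_cum big_ord_recr. Qed.

Lemma arcsine_cum_gt0 m k : 0 < arcsine_cum m k.
Proof.
elim: k => [|k ih]; last by rewrite arcsine_cumSr addr_gt0 ?arcsine_weight_gt0.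
by rewrite /arcsine_cum big_ord1 arcsine_weight_gt0.
Qed.

(* A Polya urn: the weights for [m.+1] arise from those for [m] by moving a
   fraction [(k + 1/2) / (m + 1)] of the mass from [k] to [k + 1]. *)
Lemma arcsine_cumS m k : (k <= m)%N ->
  arcsine_cum m.+1 k =
  arcsine_cum m k - arcsine_weight m k * (k%:R + 2^-1) / m.+1%:R.
Proof.
have n1 n : (n.+1%:R : R) != 0 by rewrite pnatr_eq0.
elim: k => [_|k ih km].
  rewrite /arcsine_cum !big_ord1 /arcsine_weight !subn0 central_probS central_prob0.
  have := n1 m; rewrite -natr1 => ?; by field.
rewrite (arcsine_cumSr m.+1) (arcsine_cumSr m) ih; last exact: ltnW.
rewrite /arcsine_weight subSS.
have -> : (m - k = (m - k.+1).+1)%N by lia.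
rewrite (central_probS k) (central_probS (m - k.+1)).
move: (central_prob k) (arcsine_cum m k) => u c.
have -> : (m.+1%:R : R) = (m - k.+1)%:R + k%:R + 2.
  by rewrite -!natrD; congr (_%:R); lia.
move: (m - k.+1)%N (central_prob (m - k.+1)) => l v.
have h : l%:R + k%:R + 2 != 0 :> R by rewrite -!natrD pnatr_eq0; lia.
have := n1 l; have := n1 k; rewrite -!natr1 => hk hl.
by field; rewrite h hk hl.
Qed.

(** The urn loses no mass: what leaves state [m] is exactly the new weight of state [m.+1]. *)
Lemma arcsine_cum_full m : arcsine_cum m m = 1.
Proof.
elim: m => [|m ih].
  by rewrite /arcsine_cum big_ord1 /arcsine_weight central_prob0 mulr1.
rewrite arcsine_cumSr arcsine_cumS// ih /arcsine_weight !subnn central_prob0.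
by rewrite central_probS !mulr1 subrK.
Qed.

Lemma arcsine_cum_sym m k : (k < m)%N ->
  arcsine_cum m k = 1 - arcsine_cum m (m - k.+1).
Proof.
move=> km; rewrite -(arcsine_cum_full m).
apply/eqP; rewrite eq_sym subr_eq; apply/eqP; rewrite /arcsine_cum.
rewrite (bigID (fun i : 'I_m.+1 => (i < k.+1)%N))/=.
rewrite -(big_ord_widen m.+1 (arcsine_weight m)); last lia.
(* Reversing the index turns the weights beyond [k] into those up to [m - k.+1]. *)
congr (_ + _); rewrite (reindex_inj rev_ord_inj)/=.
rewrite [RHS](big_ord_widen m.+1 (arcsine_weight m)); last lia.
apply: eq_big => i; first by have := ltn_ord i; lia.
move=> _; rewrite subSS arcsine_weight_sym//; have := ltn_ord i; lia.
Qed.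

Lemma arcsine_cum_lt1 m k : (k < m)%N -> arcsine_cum m k < 1.
Proof. by move=> /arcsine_cum_sym ->; rewrite ltrBlDr ltrDl arcsine_cum_gt0. Qed.

End discrete_arcsine.

(** * Counting paths by their nonnegative steps *)

Definition sign_step (b : bool) : int := if b then 1 else -1.

Fixpoint words (n : nat) : seq (seq bool) :=
  if n is n'.+1 then [seq true :: s | s <- words n'] ++
                     [seq false :: s | s <- words n']
  else [:: [::]].

(** The starting height is a parameter because the recursion consumes the first step and so moves
    the start. *)
Fixpoint nonneg_steps (x : int) (s : seq bool) : nat :=
  if s is b :: s' then
    (((0 <= x)%R && (0 <= x + sign_step b)%R) + nonneg_steps (x + sign_step b) s')%N
  else 0%N.

Definition path_count (n : nat) (x : int) (t : nat) : nat :=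
  count (fun s => nonneg_steps x s == t) (words n).

Lemma mem_words n s : (s \in words n) = (size s == n).
Proof.
elim: n s => [|n ih] [|b s]//=.
  by rewrite mem_cat; apply/negP => /orP[] /mapP[].
rewrite mem_cat eqSS -ih; case: b.
  rewrite mem_map; last by move=> ? ? [].
  by rewrite orbC; case: mapP => [[]|].
rewrite (mem_map (f := cons false)); last by move=> ? ? [].
by case: mapP => [[]|].
Qed.

Lemma words_uniq n : uniq (words n).
Proof.
elim: n => //= n ih; rewrite cat_uniq !map_inj_uniq ?ih//=; do ?by move=> ? ? [].
by rewrite andbT; apply/hasP => -[_ /mapP[s _ ->] /mapP[]].
Qed.

Lemma size_words n : size (words n) = (2 ^ n)%N.
Proof. by elim: n => //= n ih; rewrite size_cat !size_map ih expnS; lia. Qed.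

Lemma nonneg_steps_le x s : (nonneg_steps x s <= size s)%N.
Proof. by elim: s x => //= b s ih x; have := ih (x + sign_step b); lia. Qed.

(** From height [d] the walk cannot become negative within [d] steps. *)
Lemma nonneg_steps_ge (d : nat) s : (minn (size s) d <= nonneg_steps d s)%N.
Proof.
elim: s d => [|b s ih] d; first by rewrite min0n.
case: d => [|d]; first by rewrite minn0.
rewrite /=; case: b => /=.
  have -> : d.+1%:Z + 1 = d.+2 by lia.
  by have := ih d.+2; lia.
have -> : d.+1%:Z + -1 = d by lia.
by have := ih d; lia.
Qed.

(** The two ends of a step are adjacent integers, so they are both nonnegative or both nonpositive,
    and never both zero. Reflection exchanges the two kinds. *)
Lemma nonneg_stepsN x s :
  (nonneg_steps (- x) (map negb s) + nonneg_steps x s = size s)%N.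
Proof.
elim: s x => //= b s ih x.
have -> : - x + sign_step (~~ b) = - (x + sign_step b).
  by case: b; rewrite /=; lia.
have := ih (x + sign_step b); case: b => /=; lia.
Qed.

(* A step is nonnegative exactly when it changes the positive part of the
   position. *)
Lemma nonneg_steps_parity x s :
  odd (nonneg_steps x s + `|Num.max 0%R x|
       + `|Num.max 0%R (x + \sum_(b <- s) sign_step b)%R|)%N = false.
Proof.
elim: s x => [|b s ih] x; first by rewrite big_nil /=; lia.
have := ih (x + sign_step b); rewrite big_cons /= addrA.
move: (\sum_(_ <- _) _) => y; case: b => /=; lia.
Qed.

Lemma sign_sum_parity s : odd `|(\sum_(b <- s) sign_step b)%R|%N = odd (size s).
Proof.
elim: s => [|b s ih]; first by rewrite big_nil.
rewrite big_cons /=; move: ih; move: (\sum_(_ <- _) _) => y; case: b => /=; lia.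
Qed.

Lemma path_countS n x t : path_count n.+1 x t =
  (count (fun s => ((0 <= x)%R && (0 <= x + 1)%R + nonneg_steps (x + 1)%R s)%N == t)
         (words n) +
   count (fun s => ((0 <= x)%R && (0 <= x - 1)%R + nonneg_steps (x - 1)%R s)%N == t)
         (words n))%N.
Proof. by rewrite /path_count /= count_cat !count_map. Qed.

Lemma path_count_pos n (d t : nat) :
  path_count n.+1 d.+1 t.+1 = (path_count n d.+2 t + path_count n d t)%N.
Proof.
rewrite path_countS; congr (_ + _)%N; apply: eq_count => s /=.
  have -> : d.+1%:Z + 1 = d.+2 by lia.
  by rewrite /= add1n eqSS.
have -> : d.+1%:Z - 1 = d by lia.
by rewrite /= add1n eqSS.
Qed.

Lemma path_count0 n t :
  path_count n.+1 0 t.+1 = (path_count n 1 t + path_count n (- 1) t.+1)%N.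
Proof.
by rewrite path_countS; congr (_ + _)%N; apply: eq_count => s.
Qed.

Lemma path_countN n x t : (t <= n)%N ->
  path_count n (- x) t = path_count n x (n - t).
Proof.
(* Negating every letter permutes the words of length [n]. *)
move=> tn; have eqw : perm_eq (words n) (map (map negb) (words n)).
  apply: uniq_perm; rewrite ?map_inj_uniq ?words_uniq//.
  - by apply: inj_map => -[] [].
  - move=> s; rewrite mem_words; apply/idP/mapP => [ss|[s' + ->]].
      exists (map negb s); first by rewrite mem_words size_map.
      by rewrite -map_comp map_id_in// => b _ /=; rewrite negbK.
    by rewrite mem_words size_map.
rewrite /path_count (permP eqw) count_map; apply: eq_in_count => s.
rewrite mem_words => /eqP sn /=; have := nonneg_stepsN x s; rewrite sn.
move: (nonneg_steps _ _) (nonneg_steps _ _) => a b abn.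
apply/eqP/eqP => [bt|at_]; first by rewrite -abn bt addKn.
by apply: (@addIn a); rewrite abn at_ subnKC.
Qed.

Lemma path_count_small n (d t : nat) :
  (t < minn n d)%N -> path_count n d t = 0%N.
Proof.
move=> tnd; apply/eqP; rewrite -leqn0 leqNgt -has_count; apply/hasP => -[s].
rewrite mem_words => /eqP sn /eqP st.
by have := nonneg_steps_ge d s; rewrite sn st leqNgt tnd.
Qed.

Lemma nonneg_steps_even s : ~~ odd (size s) -> ~~ odd (nonneg_steps 0 s).
Proof.
have := nonneg_steps_parity 0 s; rewrite -sign_sum_parity add0r.
move: (\sum_(_ <- _) _) (nonneg_steps 0 s) => y a; lia.
Qed.

(** Each word of length 2m started at 0 has an even number of nonnegative steps, at most 2m, and so
    lies in exactly one class. *)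
Lemma sum_path_count m :
  (\sum_(k < m.+1) path_count (2 * m) 0 (2 * k) = 4 ^ m)%N.
Proof.
have -> : (4 ^ m = 2 ^ (2 * m))%N by rewrite expnM.
rewrite -size_words /path_count.
under eq_bigr do rewrite -sum1_count big_mkcond.
rewrite exchange_big /= -sum1_size big_seq [RHS]big_seq.
apply: eq_bigr => s; rewrite mem_words => /eqP sn.
have := nonneg_steps_le 0 s; have := @nonneg_steps_even s.
rewrite sn oddM andFb => /(_ isT).
move: (nonneg_steps 0 s) => a aev am.
have lt : (a./2 < m.+1)%N by lia.
rewrite (bigD1 (Ordinal lt))//= big1 => [|i]; first by case: eqP => //; lia.
by rewrite -val_eqE /= => ni; case: eqP => //; lia.
Qed.

Lemma sum_central_binomials m :
  (\sum_(k < m.+1) 'C(2 * k, k) * 'C(2 * (m - k), m - k) = 4 ^ m)%N.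
Proof.
apply/eqP; rewrite -(eqr_nat rat) natr_sum natrX; apply/eqP.
have x0 (k : nat) : (4 : rat) ^+ k != 0 by rewrite expf_neq0.
apply: (mulIf (invr_neq0 (x0 m))); rewrite divff// -[RHS](arcsine_cum_full m).
rewrite mulr_suml; apply: eq_bigr => i _.
rewrite /arcsine_weight /central_prob mulrACA -invfM -exprD natrM subnKC//.
by have := ltn_ord i; lia.
Qed.

(** Pascal's rule, whose two terms agree by symmetry of an odd row. *)
Lemma central_binomial_half k : (0 < k)%N ->
  ('C(2 * k, k) = 2 * 'C((2 * k).-1, k.-1))%N.
Proof.
case: k => // k _; have -> : (2 * k.+1 = (2 * k).+2)%N by lia.
rewrite [_.-1]/= [_.-1]/= binS.
have := @bin_sub (2 * k).+1 k.+1.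
rewrite (_ : (2 * k).+1 - k.+1 = k)%N; last lia.
by move=> ->; lia.
Qed.

(* The first clause needs [0 < i]: the number of paths from [d] that never become
   negative has no such closed form.  For [d = 0] the two extreme cases are equal
   by reflection, hence determined by the total [4 ^ m]. *)
Lemma path_count_formula n :
  (forall i d l : nat, (0 < i)%N -> (0 < d)%N -> n = (2 * i + d + 2 * l)%N ->
    path_count n d (d + 2 * l) = ('C(2 * i, i) * 'C(d + 2 * l, l))%N) /\
  (forall i l : nat, n = (2 * (i + l))%N ->
    path_count n 0 (2 * l) = ('C(2 * i, i) * 'C(2 * l, l))%N).
Proof.
elim: n => [|n [ihd ih0]].
  split=> [i d l|i l n0]; first lia.
  by have [-> ->] : i = 0%N /\ l = 0%N by lia.
split.
  move=> i [//|d] l i0 _ nE.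
  have -> : (d.+1 + 2 * l = (d + 2 * l).+1)%N by lia.
  rewrite path_count_pos.
  have -> : path_count n d (d + 2 * l) = ('C(2 * i, i) * 'C(d + 2 * l, l))%N.
    case: d nE => [|d] nE; first by apply: ih0; lia.
    by apply: ihd; lia.
  (* For [l = 0] the upward branch is empty: from [d.+2], with at least d + 2 steps left, more than
     [d] of them are nonnegative. Otherwise the two branches add up by Pascal's rule. *)
  case: l nE => [|l] nE.
    by rewrite muln0 addn0 !bin0 path_count_small//; lia.
  have -> : (d + 2 * l.+1 = d.+2 + 2 * l)%N by lia.
  by rewrite (ihd i)//; [rewrite binS mulnDr addnC|lia].
move=> {}i {}l nE.
(* The first step leads to 1, or to -1, which is reflected to 1. By [central_binomial_half] each
   branch contributes half of the product. *)
have inner (i' l' : nat) : (0 < i')%N -> (0 < l')%N -> n.+1 = (2 * (i' + l'))%N ->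
    path_count n.+1 0 (2 * l') = ('C(2 * i', i') * 'C(2 * l', l'))%N.
  case: l' => // l' i0 _ nE'.
  have -> : (2 * l'.+1 = (1 + 2 * l').+1)%N by lia.
  rewrite path_count0 (ihd i' 1%N)//; last lia.
  rewrite path_countN; last lia.
  have -> : (n - (1 + 2 * l').+1 = 1 + 2 * i'.-1)%N by lia.
  rewrite (ihd l'.+1 1%N)//; last lia.
  have := @central_binomial_half l'.+1 isT; have := @central_binomial_half i' i0.
  have -> : ((2 * l'.+1).-1 = 1 + 2 * l')%N by lia.
  have -> : ((2 * i').-1 = 1 + 2 * i'.-1)%N by lia.
  rewrite [l'.+1.-1]/= (_ : (1 + 2 * l').+1 = 2 * l'.+1)%N; last lia.
  by move=> -> ->; nia.
have [m mE] : exists m, n.+1 = (2 * m.+1)%N by exists (i + l).-1; lia.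
have sym : path_count n.+1 0 (2 * m.+1) = path_count n.+1 0 (2 * 0).
  by rewrite -[X in path_count _ X (2 * 0)]oppr0 path_countN ?muln0// subn0 mE.
have outer : path_count n.+1 0 (2 * 0) = 'C(2 * m.+1, m.+1).
  have split_ends (f : nat -> nat) :
      (\sum_(k < m.+2) f k = f 0 + (\sum_(k < m) f k.+1 + f m.+1))%N.
    by rewrite big_ord_recl big_ord_recr.
  have := sum_path_count m.+1; rewrite -sum_central_binomials -mE.
  rewrite (split_ends (fun k => path_count n.+1 0 (2 * k))).
  rewrite (split_ends (fun k => 'C(2 * k, k) * 'C(2 * (m.+1 - k), m.+1 - k))%N).
  rewrite sym subnn subn0 !muln0 !bin0 mul1n muln1.
  have -> : (\sum_(k < m) path_count n.+1 0 (2 * k.+1) =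
      \sum_(k < m) 'C(2 * k.+1, k.+1) * 'C(2 * (m.+1 - k.+1), m.+1 - k.+1))%N.
    apply: eq_bigr => k _; have km := ltn_ord k.
    by rewrite (inner (m.+1 - k.+1)%N k.+1)//; [rewrite mulnC|lia|lia].
  rewrite mE; lia.
case: (posnP i) => [i0|i0].
  have -> : l = m.+1 by lia.
  by rewrite i0 sym outer bin0 mul1n.
case: (posnP l) => [l0|l0]; last exact: inner.
have -> : i = m.+1 by lia.
by rewrite l0 outer bin0 muln1.
Qed.

Lemma path_count_arcsine {R : realFieldType} (m k : nat) : (k <= m)%N ->
  (path_count (2 * m) 0 (2 * k))%:R / 4 ^+ m = arcsine_weight m k :> R.
Proof.
move=> km; have [_ /(_ (m - k)%N k) ->] := path_count_formula (2 * m); last lia.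
rewrite /arcsine_weight /central_prob mulrACA -invfM -exprD subnKC//.
by rewrite mulnC natrM.
Qed.

(** * Wallis' inequality *)

Section wallis.
Context {R : realType}.

(** A primitive of the n-th power of sine, given by the reduction formula of integration by
    parts. *)
Fixpoint sin_pow_primitive (n : nat) (x : R) : R :=
  match n with
  | 0 => x
  | 1 => - cos x
  | (n'.+1 as n1).+1 =>
    (n1%:R * sin_pow_primitive n' x - sin x ^+ n1 * cos x) / n1.+1%:R
  end.

Lemma is_derive_sin_pow_primitive n (x : R) :
  is_derive x 1 (sin_pow_primitive n) (sin x ^+ n).
Proof.
elim/ltn_ind: n x => -[|[|n]] ih x /=.
- exact: is_derive_id.
- rewrite (_ : (fun x : R => - cos x) = - cos)//.
  by apply: is_derive_eq; rewrite opprK expr1.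
- have dn := ih n (ltnW (ltnSn _)) x.
  have -> : (fun x : R => (n.+1%:R * sin_pow_primitive n x -
      sin x ^+ n.+1 * cos x) / n.+2%:R) =
      n.+2%:R^-1 *: (n.+1%:R *: sin_pow_primitive n - (sin ^+ n.+1) * cos).
    by apply/funext => y; rewrite [LHS]mulrC !fctE.
  apply: is_derive_eq; rewrite /GRing.scale/=.
  have := cos2Dsin2 x; rewrite exprfctE !exprS; move: (sin x) (cos x) => s c cs.
  have c2 : c * c = 1 - s * s by rewrite -cs; ring.
  have n2 : (n.+2%:R : R) != 0 by rewrite pnatr_eq0.
  apply: (mulfI n2); rewrite mulVKf//.
  have -> : c * (n.+1%:R * s ^+ n * c) = n.+1%:R * s ^+ n * (c * c) by ring.
  by rewrite c2 -[n.+2%:R]natr1; ring.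
Qed.

(** The Wallis integral of sin^n over [0, pi/2], written through its primitive. *)
Definition wallis (n : nat) : R :=
  sin_pow_primitive n (pi / 2) - sin_pow_primitive n 0.

Lemma wallisSS n : wallis n.+2 = n.+1%:R / n.+2%:R * wallis n.
Proof.
rewrite /wallis /= cos_pihalf sin0 expr0n /= !mulr0 mul0r !subr0.
by rewrite -mulrBl -mulrBr mulrAC.
Qed.

(** The integrand decreases in [n]; the mean value theorem applied to the difference of the
    primitives carries this over to the integrals. *)
Lemma wallisS_le n : wallis n.+1 <= wallis n.
Proof.
have p0 : 0 < pi / 2 :> R by rewrite divr_gt0 ?pi_gt0.
have dg (x : R) : is_derive x 1 (sin_pow_primitive n - sin_pow_primitive n.+1)
    (sin x ^+ n - sin x ^+ n.+1).
  by have := is_derive_sin_pow_primitive n x;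
     have := is_derive_sin_pow_primitive n.+1 x => d1 d2; exact: is_deriveB.
have [|c] := @MVT_segment R _ (fun x => sin x ^+ n - sin x ^+ n.+1) _ _
    (ltW p0) (fun x _ => dg x).
  apply: continuous_subspaceT => x.
  by have [dx _] := dg x; exact/differentiable_continuous/derivable1_diffP.
rewrite in_itv => /andP[c0 cp] eg; rewrite -subr_ge0.
rewrite [leRHS](_ : _ = (sin c ^+ n - sin c ^+ n.+1) * (pi / 2 - 0)).
  apply: mulr_ge0; last by rewrite subr0 ltW.
  rewrite subr_ge0 exprS ler_piMl ?sin_le1// exprn_ge0// sin_ge0_pi//.
  by apply/andP; split; [exact: c0|rewrite (le_trans cp)//; lra].
by rewrite -eg /wallis addrfctE opprfctE; ring.
Qed.

Lemma wallis_even k : wallis (2 * k) = pi / 2 * central_prob k.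
Proof.
elim: k => [|k ih]; first by rewrite muln0 /wallis /= central_prob0; lra.
have -> : (2 * k.+1 = (2 * k).+2)%N by lia.
rewrite wallisSS ih central_probS.
have : k.+1%:R != 0 :> R by rewrite pnatr_eq0.
have : (2 * k).+2%:R != 0 :> R by rewrite pnatr_eq0.
rewrite -!natr1 natrM => h1 h2; field; lra.
Qed.

Lemma wallis_odd k : wallis (2 * k).+1 * ((2 * k%:R + 1) * central_prob k) = 1.
Proof.
elim: k => [|k ih].
  by rewrite muln0 /wallis /= central_prob0 cos_pihalf cos0; lra.
have -> : (2 * k.+1 = (2 * k).+2)%N by lia.
rewrite wallisSS central_probS -[RHS]ih.
have : k.+1%:R != 0 :> R by rewrite pnatr_eq0.
have : (2 * k).+3%:R != 0 :> R by rewrite pnatr_eq0.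
rewrite -!natr1 natrM => h1 h2; field; lra.
Qed.

(* This is [wallis (2 * k + 2) <= wallis (2 * k + 1)]. *)
Lemma central_prob_sqr_half k :
  pi * central_prob k ^+ 2 * (k%:R + 2^-1) ^+ 2 <= k%:R + 1 :> R.
Proof.
have := wallisS_le (2 * k).+1.
have -> : ((2 * k).+2 = 2 * k.+1)%N by lia.
rewrite wallis_even central_probS => h.
have u0 := @central_prob_gt0 R k; have o := wallis_odd k.
have k0 : (0 : R) <= k%:R by [].
have w0 : 0 <= (2 * k%:R + 1) * @central_prob R k by rewrite mulr_ge0//; lra.
have := ler_wpM2r w0 h; rewrite o -[k.+1%:R]natr1.
move: (central_prob k) (k%:R) k0 => u x x0 hh.
have x1 : 0 < x + 1 by lra.
rewrite -[leRHS]mul1r -ler_pdivrMr//; apply: le_trans hh.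
by rewrite le_eqVlt; apply/orP; left; apply/eqP; field; lra.
Qed.

(** The preceding bound at [k], rewritten by [central_probS], is this bound at [k.+1]. *)
Lemma central_prob_sqr k : pi * central_prob k ^+ 2 * k%:R <= 1 :> R.
Proof.
case: k => [|k]; first by rewrite mulr0.
have := central_prob_sqr_half k; rewrite central_probS -[k.+1%:R]natr1.
have : (0 : R) <= k%:R by [].
move: (central_prob k) (k%:R) => u x x0 h.
have x1 : 0 < x + 1 by lra.
rewrite -(@ler_pM2r _ (x + 1))// mul1r; apply: le_trans h.
by rewrite le_eqVlt; apply/orP; left; apply/eqP; field; lra.
Qed.
End wallis.

(** * Comparison of the distribution functions *)

Section arcsine_quantile.
Context {R : realType}.

(** This is the distribution function only on [0, 1], where the argument of [asin] lies in
    [-1, 1]. *)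
Definition arcsine_cdf (x : R) : R := asin (2 * x - 1) / pi + 2^-1.

(** Inverse of [arcsine_cdf] on [0, 1]. *)
Definition arcsine_quantile (t : R) : R := (1 + sin (pi * (t - 2^-1))) / 2.

Let pi0 : 0 < pi :> R. Proof. exact: pi_gt0. Qed.

Lemma arcsine_cdf_itv x : 0 <= x <= 1 -> 0 <= arcsine_cdf x <= 1.
Proof.
move=> /andP[x0 x1]; have y1 : -1 <= 2 * x - 1 <= 1 by apply/andP; split; lra.
have := asin_geNpi2 y1; have := asin_lepi2 y1; rewrite /arcsine_cdf => a1 a2.
have : - 2^-1 <= asin (2 * x - 1) / pi by rewrite ler_pdivlMr//; lra.
have : asin (2 * x - 1) / pi <= 2^-1 by rewrite ler_pdivrMr//; lra.
by move=> ? ?; apply/andP; split; lra.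
Qed.

Lemma arcsine_cdfK x : 0 <= x <= 1 -> arcsine_quantile (arcsine_cdf x) = x.
Proof.
move=> /andP[x0 x1]; rewrite /arcsine_quantile /arcsine_cdf addrK (mulrC pi) divfK ?gt_eqF//.
by rewrite asinK ?in_itv/=; [field|apply/andP; split; lra].
Qed.

Lemma quantile_angle t : 0 <= t <= 1 ->
  pi * (t - 2^-1) \in `[(- (pi / 2)), (pi / 2 : R)].
Proof.
move=> /andP[t0 t1]; rewrite in_itv/=; apply/andP; split.
  by rewrite -mulrN ler_pM2l//; lra.
by rewrite ler_pM2l//; lra.
Qed.

Lemma arcsine_quantile_lt s t : 0 <= s <= 1 -> 0 <= t <= 1 ->
  (arcsine_quantile s < arcsine_quantile t) = (s < t).
Proof.
move=> s01 t01; rewrite /arcsine_quantile ltr_pM2r ?invr_gt0// ltrD2l.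
by rewrite ltr_sin ?quantile_angle// ltr_pM2l// ltrD2r.
Qed.

Lemma arcsine_quantile_le s t : 0 <= s <= 1 -> 0 <= t <= 1 ->
  (arcsine_quantile s <= arcsine_quantile t) = (s <= t).
Proof. by move=> s01 t01; rewrite !leNgt arcsine_quantile_lt. Qed.

Lemma arcsine_quantile_sym t :
  arcsine_quantile (1 - t) = 1 - arcsine_quantile t.
Proof.
rewrite /arcsine_quantile.
have -> : pi * (1 - t - 2^-1) = - (pi * (t - 2^-1)) :> R by field.
by rewrite sinN; field.
Qed.

Lemma is_derive_arcsine_cdf (x : R) : 0 < x < 1 ->
  is_derive x 1 arcsine_cdf (pi * Num.sqrt (x * (1 - x)))^-1.
Proof.
move=> x01; have dx := is_derive_arcsine x01.
have -> : arcsine_cdf = (fun x => asin (2 * x - 1) / pi) + cst 2^-1 by [].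
by rewrite -[X in is_derive _ _ _ X]addr0; apply: is_deriveD.
Qed.

Lemma arcsine_quantileK t : 0 <= t <= 1 ->
  arcsine_cdf (arcsine_quantile t) = t.
Proof.
move=> t01; rewrite /arcsine_cdf /arcsine_quantile.
have -> : 2 * ((1 + sin (pi * (t - 2^-1))) / 2) - 1 = sin (pi * (t - 2^-1)) :> R.
  by field.
by rewrite sinK ?quantile_angle// mulrC mulKf ?gt_eqF// subrK.
Qed.

Lemma arcsine_quantile_itv t : 0 < t < 1 -> 0 < arcsine_quantile t < 1.
Proof.
move=> /andP[t0 t1]; have q0 : arcsine_quantile 0 = 0.
  by rewrite /arcsine_quantile sub0r mulrN sinN sin_pihalf; field.
have q1 : arcsine_quantile 1 = 1.
  by rewrite -(subr0 1) arcsine_quantile_sym q0.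
have t01 : 0 <= t <= 1 by rewrite !ltW.
by rewrite -[X in X < _ < _]q0 -[X in _ < _ < X]q1 !arcsine_quantile_lt ?t0 ?lexx ?ler01.
Qed.

(* This and [arcsine_cumS] say that [arcsine_cdf ((k + 1) / n)] decreases in [n]
   faster than [arcsine_cum n k]. *)
Lemma arcsine_cdf_step (n k : nat) : (k.+1 < n)%N ->
  arcsine_weight n k * (k%:R + 2^-1) / n.+1%:R <=
  arcsine_cdf (k.+1%:R / n%:R) - arcsine_cdf (k.+1%:R / n.+1%:R).
Proof.
move=> kn.
have [l nE] : exists l, n = (k + l.+2)%N by exists (n - k).-2; lia.
have k0 : 0 <= k%:R :> R by [].
have l0 : 0 <= l%:R :> R by [].
set a := k.+1%:R / n.+1%:R; set b := k.+1%:R / n%:R.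
have nR : n%:R = k%:R + l%:R + 2 :> R by rewrite nE -!natrD; congr (_%:R); lia.
have n1R : n.+1%:R = k%:R + l%:R + 3 :> R by rewrite nE -!natrD; congr (_%:R); lia.
have k1R : k.+1%:R = k%:R + 1 :> R by rewrite -natr1.
have wE : arcsine_weight n k = central_prob k * central_prob l.+2 :> R.
  by rewrite /arcsine_weight; congr (_ * central_prob _); lia.
clear nE kn.
have a0 : 0 < a by rewrite divr_gt0.
have b1 : b < 1 by rewrite /b ltr_pdivrMr nR ?k1R; lra.
have ab : b - a = (k%:R + 1) / ((k%:R + l%:R + 2) * (k%:R + l%:R + 3)).
  by rewrite /a /b nR n1R k1R; field; lra.
have ltab : a < b.
  by rewrite -subr_gt0 ab divr_gt0 ?mulr_gt0//; lra.
(* The difference of the distribution functions becomes [b - a] times the density at some [c]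
   between [a] and [b]. *)
have [||c] :=
  @MVT R arcsine_cdf (fun x => (pi * Num.sqrt (x * (1 - x)))^-1) a b ltab.
- move=> x; rewrite in_itv/= => /andP[ax xb].
  by apply: is_derive_arcsine_cdf; apply/andP; split; lra.
- apply: continuous_in_subspaceT => x; rewrite inE/= in_itv/= => /andP[ax xb].
  have [|dx _] := @is_derive_arcsine_cdf x; first by apply/andP; split; lra.
  exact/differentiable_continuous/derivable1_diffP.
rewrite in_itv/= => /andP[ac cb] ->; rewrite ab.
have c0 : 0 < c by lra.
have c1 : 0 < 1 - c by lra.
set s := Num.sqrt _.
have s0 : 0 < s by rewrite sqrtr_gt0 mulr_gt0.
have s2 : s ^+ 2 = c * (1 - c) by rewrite sqr_sqrtr// mulr_ge0// ltW.
rewrite n1R ler_pdivrMr; last lra.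
rewrite [leRHS](_ : _ = (k%:R + 1) / (k%:R + l%:R + 2) / (pi * s)); last first.
  have alg (p A B D : R) : p != 0 -> B != 0 -> D != 0 ->
      p^-1 * (A / (B * D)) * D = A / B / p.
    by move=> p0 B0 D0; field; rewrite p0 B0 D0.
  by rewrite alg// gt_eqF ?mulr_gt0//; lra.
rewrite ler_pdivlMr ?mulr_gt0// ler_pdivlMr; last lra.
rewrite wE.
have := @central_prob_sqr_half R k; have := @central_prob_sqr R l.+2.
rewrite (_ : l.+2%:R = l%:R + 2 :> R); last by rewrite -natrD addn2.
have := @central_prob_gt0 R k; have := @central_prob_gt0 R l.+2.
(* The bound c < b controls [c], and c > a controls [1 - c]; together they bound c (1 - c), which
   the density contains. *)
have cN : c * (k%:R + l%:R + 2) <= k%:R + 1.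
  by move: cb; rewrite /b nR k1R ltr_pdivlMr; [exact: ltW|lra].
have cN' : (1 - c) * (k%:R + l%:R + 2) <= l%:R + 2.
  have : k%:R + 1 < c * (k%:R + l%:R + 3).
    by move: ac; rewrite /a n1R k1R ltr_pdivrMr//; lra.
  lra.
move: (central_prob k) (central_prob l.+2) (k%:R) (l%:R) k0 l0 cN cN' => u v x y.
move=> x0 y0 cN cN' v0 u0 hv hu.
(* Squaring removes the root. The left side then splits into pi u^2 (x + 1/2)^2 c (x + y + 2), at
   most (x + 1)^2, and pi v^2 (1 - c) (x + y + 2), at most 1, by the two Wallis bounds. *)
rewrite -(@ler_pXn2r _ 2) ?nnegrE//; last first.
- by lra.
- by rewrite ?mulr_ge0// ?ltW//; lra.
rewrite [leLHS](_ : _ = (pi * u ^+ 2 * (x + 2^-1) ^+ 2) * (pi * v ^+ 2) *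
   ((c * (x + y + 2)) * ((1 - c) * (x + y + 2)))); last first.
  by rewrite !exprMn s2; ring.
rewrite mulrACA -[leRHS]mulr1 [(x + 1) ^+ 2]expr2.
have pu0 : 0 <= pi * u ^+ 2 * (x + 2^-1) ^+ 2.
  apply: mulr_ge0 (sqr_ge0 _); apply: mulr_ge0 (sqr_ge0 _); exact: ltW.
have pv0 : 0 <= pi * v ^+ 2 by apply: mulr_ge0 (sqr_ge0 _); exact: ltW.
have c00 : 0 <= c * (x + y + 2) by rewrite mulr_ge0 ?ltW//; lra.
have c10 : 0 <= (1 - c) * (x + y + 2) by rewrite mulr_ge0 ?ltW//; lra.
apply: (ler_pM (mulr_ge0 pu0 c00) (mulr_ge0 pv0 c10)); first exact: ler_pM.
by apply: le_trans hv; exact: ler_wpM2l.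
Qed.

(** For fixed [k] this forces the cumulative weight to 0 as [n] grows. Each of the k + 1 weights is
    at most u_(n-j), hence at most 1 / sqrt (n - k). *)
Lemma arcsine_cum_le (n k : nat) : (k < n)%N ->
  arcsine_cum n k <= k.+1%:R / Num.sqrt (n - k)%:R :> R.
Proof.
move=> kn; have nk0 : 0 < (n - k)%:R :> R by rewrite ltr0n subn_gt0.
have uub j : @central_prob R j ^+ 2 * j%:R <= 1.
  have := @central_prob_sqr R j; apply: le_trans.
  rewrite -mulrA ler_peMl ?mulr_ge0 ?sqr_ge0//.
  by apply: le_trans (pi_ge2 R); lra.
have u1 j : @central_prob R j <= 1.
  elim: j => [|j ih]; first by rewrite central_prob0.
  rewrite central_probS ler_pdivrMr// mul1r -natr1.
  have j0 : 0 <= j%:R :> R by [].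
  apply: (@le_trans _ _ (1 * (j%:R + 2^-1))); last by lra.
  by rewrite ler_wpM2r//; lra.
have -> : k.+1%:R / Num.sqrt (n - k)%:R =
    \sum_(j < k.+1) (Num.sqrt (n - k)%:R)^-1 :> R.
  by rewrite sumr_const card_ord mulr_natl.
apply: ler_sum => j _; rewrite /arcsine_weight -[leRHS]mul1r.
have jk := ltn_ord j.
have cg i : 0 <= @central_prob R i by exact/ltW/central_prob_gt0.
apply: (ler_pM (cg _) (cg _) (u1 _)).
rewrite -(@ler_pXn2r _ 2) ?nnegrE ?invr_ge0 ?sqrtr_ge0//.
rewrite exprVn sqr_sqrtr; last exact: ltW.
rewrite -[leRHS]mul1r ler_pdivlMr//.
apply: le_trans (uub (n - j)%N); apply: ler_wpM2l; first exact: sqr_ge0.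
by rewrite ler_nat; lia.
Qed.

(** A positive excess [e] would persist for all larger [m], while the cumulative weight tends to 0
    and [arcsine_cdf] stays nonnegative. *)
Lemma arcsine_cum_le_cdf (m k : nat) : (k.+1 < m)%N ->
  arcsine_cum m k <= arcsine_cdf (k.+1%:R / m%:R).
Proof.
move=> km; rewrite leNgt; apply/negP => lt0.
set e := arcsine_cum m k - arcsine_cdf (k.+1%:R / m%:R).
have e0 : 0 < e by rewrite subr_gt0.
have mono i : e <= arcsine_cum (m + i) k - arcsine_cdf (k.+1%:R / (m + i)%:R).
  elim: i => [|i ih]; first by rewrite addn0.
  apply: le_trans ih _; rewrite addnS arcsine_cumS; last lia.
  have := @arcsine_cdf_step (m + i) k; rewrite ltn_addr// => /(_ isT).
  move: (arcsine_weight _ _ * _ / _) (arcsine_cum _ _) => w x. lra.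
(* [N] makes (k + 1) / sqrt N smaller than [e]; the extra [k] in the index [m + (k + N)] keeps its
   distance from [k] at least [N]. *)
have [N eN] : exists N, (k.+1%:R / e) ^+ 2 < N%:R.
  by eexists; exact: truncnS_gt.
have := mono (k + N)%N.
have nn : (k.+1 < m + (k + N))%N by lia.
have /andP[c0 _] : 0 <= arcsine_cdf (k.+1%:R / (m + (k + N))%:R) <= 1.
  apply: arcsine_cdf_itv; rewrite divr_ge0//= ler_pdivrMr ?mul1r.
    by rewrite ler_nat ltnW.
  by rewrite ltr0n; lia.
have := @arcsine_cum_le (m + (k + N)) k; rewrite ltnW// => /(_ isT).
set s := Num.sqrt _.
have : k.+1%:R / s < e.
  have s0 : 0 < s by rewrite sqrtr_gt0 ltr0n; lia.
  rewrite ltr_pdivrMr// mulrC -ltr_pdivrMr//.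
  rewrite -(@ltr_pXn2r _ 2) ?nnegrE ?divr_ge0 ?ltW// sqr_sqrtr//.
  by apply: lt_le_trans eN _; rewrite ler_nat; lia.
by move: c0; lra.
Qed.

Lemma arcsine_cum_itv m k : (k < m)%N -> 0 <= @arcsine_cum R m k <= 1.
Proof. by move=> km; rewrite !ltW ?arcsine_cum_gt0 ?arcsine_cum_lt1. Qed.

Lemma arcsine_quantile_cum_le (m k : nat) : (k < m)%N ->
  arcsine_quantile (arcsine_cum m k) <= k.+1%:R / m%:R.
Proof.
move=> km; have m0 : 0 < m%:R :> R by rewrite ltr0n; lia.
(* For [k.+1 = m] the bound is 1, and sin <= 1 suffices. *)
have [->|kNm] := eqVneq k.+1 m.
  rewrite divff ?gt_eqF// /arcsine_quantile.
  by have := sin_le1 (pi * (arcsine_cum m k - 2^-1) : R); lra.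
have km' : (k.+1 < m)%N by lia.
have x01 : 0 <= (k.+1%:R / m%:R : R) <= 1.
  by rewrite divr_ge0//= ler_pdivrMr// mul1r ler_nat; lia.
rewrite -[leRHS]arcsine_cdfK// arcsine_quantile_le ?arcsine_cdf_itv ?arcsine_cum_itv//.
exact: arcsine_cum_le_cdf.
Qed.

(** The upper bound at the mirrored index [m - k.+1]. *)
Lemma arcsine_quantile_cum_ge (m k : nat) : (k < m)%N ->
  k%:R / m%:R <= arcsine_quantile (arcsine_cum m k).
Proof.
move=> km; have m0 : m%:R != 0 :> R by rewrite pnatr_eq0; lia.
rewrite arcsine_cum_sym// arcsine_quantile_sym.
have km' : (m - k.+1 < m)%N by lia.
have := arcsine_quantile_cum_le m _ km'; rewrite subnSK//.
rewrite natrB; last exact: ltnW km.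
rewrite mulrBl divff//; move: (k%:R / m%:R) (arcsine_quantile _) => x y.
lra.
Qed.

End arcsine_quantile.

(** * The arcsine law of half-lines *)

Section arcsine_prob.
Context {R : realType}.
Local Notation nu := (@arcsine_prob R).
Local Notation Q := (@arcsine_quantile R).

(** The interval is compact in ]0, 1[, away from the singularities of the density, so the
    fundamental theorem of calculus applies. *)
Lemma arcsine_prob_itv s t : 0 < s -> s < t -> t < 1 ->
  nu `[Q s, Q t] = (t - s)%:E.
Proof.
move=> s0 st t1.
have /andP[qs0 qs1] : 0 < Q s < 1 by apply: arcsine_quantile_itv; lra.
have /andP[qt0 qt1] : 0 < Q t < 1 by apply: arcsine_quantile_itv; lra.
have sub x : Q s <= x <= Q t -> 0 < x < 1.
  by move=> /andP[? ?]; apply/andP; split; lra.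
rewrite /arcsine_prob.
transitivity (\int[@lebesgue_measure R]_(x in `[Q s, Q t])
    ((pi * Num.sqrt (x * (1 - x)))^-1)%:E)%E.
  apply: eq_integral => x; rewrite inE/= in_itv/= => /sub x01.
  by rewrite /arcsine_pdf indicE mem_set ?mulr1//= in_itv.
have dF x : 0 < x < 1 -> {for x, continuous (@arcsine_cdf R)}.
  move=> /is_derive_arcsine_cdf[dx _].
  exact/differentiable_continuous/derivable1_diffP.
rewrite (@continuous_FTC2 _ _ (@arcsine_cdf R)).
- by rewrite !arcsine_quantileK ?EFinB//; lra.
- by rewrite arcsine_quantile_lt//; lra.
- apply: continuous_in_subspaceT => x; rewrite inE/= in_itv/= => /sub.
  exact: continuous_arcsine_pdf0.
- split.
  + move=> x; rewrite in_itv/= => /andP[/ltW ? /ltW ?].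
    by have [] := @is_derive_arcsine_cdf R x (sub _ _); [apply/andP|].
  + by apply: cvg_at_right_filter; apply: dF; rewrite qs0.
  + by apply: cvg_at_left_filter; apply: dF; rewrite qt0.
- move=> x; rewrite in_itv/= => /andP[/ltW ? /ltW ?].
  rewrite derive1E; have /is_derive_arcsine_cdf dx : 0 < x < 1.
    by apply: sub; apply/andP.
  by rewrite derive_val.
Qed.

(** Compact intervals inside the half-line and inside its complement bound their masses below by t
    and 1 - t; the total mass 1 forces equality. *)
Lemma arcsine_prob_itvNyc t : 0 < t < 1 -> nu `]-oo, Q t] = t%:E.
Proof.
move=> /andP[t0 t1].
have fin A : measurable A -> nu A \is a fin_num by move=> mA; exact: fin_num_measure.
have ge_t : t <= fine (nu `]-oo, Q t]).
  apply/ler_addgt0Pr => e e0; pose s := Num.min e (t / 2).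
  have s0 : 0 < s by rewrite lt_min e0; lra.
  have se : s <= e by rewrite ge_min lexx.
  have st : s <= t / 2 by rewrite ge_min lexx orbT.
  have : t - s <= fine (nu `]-oo, Q t]).
    rewrite -lee_fin fineK ?fin// -arcsine_prob_itv; [|lra|lra|lra].
    by rewrite le_measure ?inE//; apply: subset_itvr; rewrite bnd_simp.
  lra.
have ge_1t : 1 - t <= fine (nu (~` `]-oo, Q t])).
  (* Both ends lose [s], hence e / 2; the third of 1 - t keeps t + s below 1 - s. *)
  apply/ler_addgt0Pr => e e0; pose s := Num.min (e / 2) ((1 - t) / 3).
  have s0 : 0 < s by rewrite lt_min; apply/andP; split; lra.
  have se : s <= e / 2 by rewrite ge_min lexx.
  have st : s <= (1 - t) / 3 by rewrite ge_min lexx orbT.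
  have : (1 - s) - (t + s) <= fine (nu (~` `]-oo, Q t])).
    rewrite -lee_fin fineK; last exact/fin/measurableC.
    rewrite -arcsine_prob_itv; [|lra|lra|lra].
    rewrite le_measure ?inE//; first exact: measurableC.
    move=> x /=; rewrite !in_itv/= => /andP[+ _] => qx; apply/negP; rewrite -ltNge.
    by apply: lt_le_trans qx; rewrite arcsine_quantile_lt//; lra.
  lra.
have fA := fin _ (measurable_itv `]-oo, Q t]).
move: ge_1t; rewrite probability_setC//.
rewrite [X in (1 - X)%E](_ : _ = (fine (nu `]-oo, Q t]))%:E); last by rewrite fineK.
rewrite -[LHS]fineK// => /= ?; congr EFin; lra.
Qed.

End arcsine_prob.

(** * Integration against a finitely supported law *)

Section finitely_supported_law.
Context {d : measure_display} {T : measurableType d} {R : realType}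
  (P : probability T R) (X : T -> R) (n : nat) (v p : nat -> R) (g : R -> R).
Hypothesis mX : measurable_fun setT X.
Hypothesis mg : measurable_fun setT g.
Hypothesis vI : {in gtn n &, injective v}.
(* Lower bounds suffice, as the [p i] sum to 1. *)
Hypothesis pP : forall i, (i < n)%N -> ((p i)%:E <= P (X @^-1` [set v i]))%E.
Hypothesis p1 : \sum_(i < n) p i = 1.

Let A i := X @^-1` [set v i].

Let mA i : measurable (A i).
Proof. by rewrite -[A i]setTI; exact: mX. Qed.

Let tA : trivIset `I_n A.
Proof.
move=> i j /= ni nj [x [/= xi xj]]; apply: vI; rewrite ?inE//.
by rewrite -xi -xj.
Qed.

Let D := \bigcup_(i < n) A i.

Let mD : measurable D. Proof. exact: bigcup_measurable. Qed.

Let PD : P D = (\sum_(i < n) fine (P (A i)))%:E.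
Proof.
rewrite measure_fin_bigcup// -fsbig_ord -sumEFin.
by apply: eq_bigr => i _; rewrite fineK// fin_num_measure.
Qed.

(** The atoms are disjoint and have total mass at most 1, so no lower bound can be strict. *)
Lemma finite_law_mass i : (i < n)%N -> P (X @^-1` [set v i]) = (p i)%:E.
Proof.
move=> ni.
have pA j : (j < n)%N -> p j <= fine (P (A j)).
  by move=> nj; rewrite -lee_fin fineK ?fin_num_measure//; exact: pP.
have D1 : \sum_(j < n) fine (P (A j)) <= 1.
  by rewrite -lee_fin -PD probability_le1.
rewrite -/(A i) -(fineK (fin_num_measure P _ (mA i))); congr EFin.
apply/eqP; rewrite eq_le pA// andbT.
move: D1; rewrite -p1 -subr_ge0 -sumrB (bigD1 (Ordinal ni))//= => D1.
rewrite -subr_ge0; apply: le_trans D1 _.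
by rewrite gerDl sumr_le0// => j _; rewrite subr_le0 pA.
Qed.

Let PN : P (~` D) = 0%E.
Proof.
rewrite probability_setC// PD (eq_bigr (fun i : 'I_n => p i)) ?p1 ?subee//.
by move=> i _; rewrite finite_law_mass.
Qed.

Let s (x : T) := (\sum_(i < n) (g (v i) * \1_(A i) x)%:E)%E.

Let gXE x : D x -> (g (X x))%:E = s x.
Proof.
move=> [i /= ni xi]; rewrite /s (bigD1 (Ordinal ni))//= big1 ?adde0.
  by rewrite indicE mem_set// mulr1 xi.
move=> j ji; rewrite indicE memNset ?mulr0// => xj; move/negP: ji; apply.
by apply/eqP/val_inj; apply: tA => //=; exists x.
Qed.

Let int_term (i : 'I_n) :
  P.-integrable setT (fun x => (g (v i) * \1_(A i) x)%:E).
Proof.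
under eq_fun do rewrite EFinM.
by apply: integrableZl => //; exact: integrable_indic.
Qed.

Let int_s : P.-integrable setT s.
Proof. by apply: integrable_sum => // i _; exact: int_term. Qed.

Let m_gX : measurable_fun setT (EFin \o (g \o X)).
Proof. by apply/measurable_EFinP; exact: measurableT_comp. Qed.

Lemma integrable_finite_law : P.-integrable setT (fun x => (g (X x))%:E).
Proof.
apply/(negligible_integrable (measurableC mD) measurableT) => //.
rewrite setDE setCK setTI.
apply: (@eq_integrable _ _ _ P D mD s).
  by move=> x; rewrite inE => /gXE.
exact: integrableS int_s.
Qed.

Lemma integral_finite_law :
  (\int[P]_x (g (X x))%:E = (\sum_(i < n) p i * g (v i))%:E)%E.
Proof.
rewrite (negligible_integral (measurableC mD) measurableT integrable_finite_law PN).
rewrite setDE setCK setTI.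
under eq_integral => x do rewrite inE => /gXE ->.
(* On [D] the integrand is now the simple function [s]; returning to the whole space lets it be
   integrated term by term. *)
rewrite -[D]setTI -[D]setCK -setDE -negligible_integral//; last exact: measurableC.
rewrite /s integral_sum// -sumEFin; apply: eq_bigr => i _.
under eq_integral do rewrite EFinM.
rewrite integralZl//; last exact: integrable_indic.
rewrite integral_indic// setIT EFinM muleC; congr (_ * _)%E.
exact: finite_law_mass.
Qed.

End finitely_supported_law.

(** * The monotone coupling *)

Section quantile_coupling.
Context {R : realType}.
Variable m : nat.
Hypothesis m0 : (0 < m)%N.
Local Notation nu := (@arcsine_prob R).

(** For k < m, the point where [discretization] jumps from k/m to (k + 1)/m. *)
Definition cut_point (k : nat) : R := arcsine_quantile (arcsine_cum m k).

(* Under [arcsine_prob], the pair [(x, discretization x)] is the monotone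
   coupling of the arcsine law and the discrete arcsine law on [{k / m}]. *)
Definition discretization (x : measurableTypeR R) : R :=
  m%:R^-1 * \sum_(k < m) \1_(~` `]-oo, cut_point k]) x.

Lemma measurable_discretization : measurable_fun setT discretization.
Proof.
apply: measurable_funM => //; apply: measurable_sum => k.
by apply: measurable_indic; exact: measurableC.
Qed.

Lemma cut_point_le i j : (i <= j)%N -> (j < m)%N -> cut_point i <= cut_point j.
Proof.
move=> ij jm; rewrite arcsine_quantile_le ?arcsine_cum_itv//; last first.
  exact: leq_ltn_trans jm.
elim: j ij {jm} => [|j ih]; first by rewrite leqn0 => /eqP ->.
rewrite leq_eqVlt => /predU1P[->//|/ih ij]; apply: le_trans ij _.
by rewrite arcsine_cumSr lerDl ltW// arcsine_weight_gt0.
Qed.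

Lemma sum_ltn_ord (k n : nat) : (k <= n)%N -> (\sum_(j < n) (j < k) = k)%N.
Proof.
move=> kn; rewrite -[RHS]card_ord -sum1_card (big_ord_widen n (fun=> 1%N) kn).
by rewrite [RHS]big_mkcond; apply: eq_bigr => j _; case: ltnP.
Qed.

Lemma discretizationP x : exists k : nat, [/\ (k <= m)%N,
  discretization x = k%:R / m%:R &
  forall j, (j < m)%N -> (x <= cut_point j) = (k <= j)%N].
Proof.
(* The index sought is that of the first cut point not below [x], or [m] if there is none. *)
have exk : exists k, (k == m) || (x <= cut_point k) by exists m; rewrite eqxx.
case: (ex_minnP exk) => k kP kmin; exists k.
have km : (k <= m)%N by apply: kmin; rewrite eqxx.
have kj j : (j < m)%N -> (x <= cut_point j) = (k <= j)%N.
  move=> jm; apply/idP/idP => [xj|kj]; first by apply: kmin; rewrite xj orbT.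
  case/predU1P: kP => [kE|xk]; first by lia.
  exact: le_trans xk (cut_point_le _ _ kj jm).
split=> //; rewrite /discretization mulrC; congr (_ / _).
rewrite -[in RHS](sum_ltn_ord _ _ km) natr_sum; apply: eq_bigr => j _.
rewrite indicE ltnNge -kj//; congr (_%:R); apply/congr1.
by apply/idP/negP; rewrite inE/= in_itv/=.
Qed.

(** The j-th cut point lies in [j/m, (j + 1)/m], and [x] lies between the cut points of index k - 1
    and k, with 0 and 1 as outer bounds. *)
Lemma discretization_close x : 0 < x < 1 -> `|discretization x - x| <= m%:R^-1.
Proof.
move=> /andP[x0 x1]; have [k [km -> kj]] := discretizationP x.
have mR : 0 < m%:R :> R by rewrite ltr0n.
have up : x <= k%:R / m%:R + m%:R^-1.
  have [{}km|mk] := ltnP k m.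
    have := arcsine_quantile_cum_le m k km (R := R).
    rewrite -natr1 mulrDl mul1r; apply: le_trans.
    by rewrite -/(cut_point k) kj.
  have -> : k = m by lia.
  by rewrite divff ?gt_eqF// (le_trans (ltW x1))// lerDl invr_ge0 ltW.
have lo : k%:R / m%:R - m%:R^-1 <= x.
  case: k km kj {up} => [_ _|k km kj].
    by rewrite mul0r sub0r (le_trans _ (ltW x0))// oppr_le0 invr_ge0 ltW.
  rewrite -natr1 mulrDl mul1r addrK.
  have := arcsine_quantile_cum_ge m k km (R := R); rewrite -/(cut_point k).
  move/le_trans; apply; apply: ltW; rewrite ltNge kj//; lia.
by rewrite ler_norml; apply/andP; split; lra.
Qed.

(** The fibre over k/m contains the interval between two successive cut points, a half-line if k = 0
    or k = m, whose mass is a difference of cumulative weights. *)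
Lemma discretization_mass k : (k < m.+1)%N ->
  ((arcsine_weight m k)%:E <= nu (discretization @^-1` [set (k%:R / m%:R)%R]))%E.
Proof.
rewrite ltnS => km.
have nuQ j : (j < m)%N -> nu `]-oo, cut_point j] = (arcsine_cum m j)%:E.
  by move=> jm; rewrite arcsine_prob_itvNyc// arcsine_cum_gt0 arcsine_cum_lt1.
have mP : measurable (discretization @^-1` [set k%:R / m%:R]).
  by rewrite -[X in measurable X]setTI; exact: measurable_discretization.
have inP x : (forall j, (j < m)%N -> (x <= cut_point j) = (k <= j)%N) ->
    discretization x = k%:R / m%:R.
  move=> xk; have [k' [km' -> xk']] := discretizationP x.
  congr (_%:R / _); apply/eqP; rewrite eqn_leq; apply/andP; split.
    by have [|] := ltnP k m; [move=> km1; rewrite -xk' ?xk|lia].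
  by have [|] := ltnP k' m; [move=> km1; rewrite -xk ?xk'|lia].
case: k km mP inP => [|k] km mP inP.
  have -> : arcsine_weight m 0 = arcsine_cum m 0 :> R by rewrite /arcsine_cum big_ord1.
  rewrite -nuQ// le_measure ?inE// => x /=; rewrite in_itv/= => x0.
  by apply: inP => j jm; rewrite leq0n (le_trans x0)// cut_point_le.
have [km'|mk] := ltnP k.+1 m.
  have -> : arcsine_weight m k.+1 = arcsine_cum m k.+1 - arcsine_cum m k :> R.
    by rewrite arcsine_cumSr addrAC subrr add0r.
  rewrite EFinB -!nuQ//.
  have sub : `]-oo, cut_point k] `<=` `]-oo, cut_point k.+1].
    by apply: subset_itvl; rewrite bnd_simp cut_point_le.
  have <- : nu (`]-oo, cut_point k.+1] `\` `]-oo, cut_point k]) =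
      (nu `]-oo, cut_point k.+1] - nu `]-oo, cut_point k])%E.
    rewrite measureD// ?ltey_eq ?fin_num_measure//; congr (_ - nu _)%E.
    exact: setIidr.
  rewrite le_measure ?inE//; first exact: measurableD.
  move=> x /=; rewrite !in_itv/= => -[xk1 /negP]; rewrite -ltNge => xk.
  apply: inP => j jm; apply/idP/idP => [xj|kj].
    by rewrite ltnNge; apply/negP => jk; have := cut_point_le _ _ jk (ltnW km'); lra.
  exact: le_trans xk1 (cut_point_le _ _ kj jm).
have mE : m = k.+1 by lia.
have -> : arcsine_weight m k.+1 = 1 - arcsine_cum m k :> R.
  have := @arcsine_cum_full R m; rewrite [X in arcsine_cum _ X]mE arcsine_cumSr.
  by move=> <-; rewrite addrAC subrr add0r.
have km' : (k < m)%N by rewrite mE.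
rewrite EFinB -nuQ// -probability_setC//.
rewrite le_measure ?inE//; first exact: measurableC.
move=> x /=; rewrite !in_itv/= => /negP; rewrite -ltNge => xk.
apply: inP => j jm; apply/idP/idP => [xj|kj]; last by lia.
have jk : (j <= k)%N by lia.
by have := cut_point_le _ _ jk km'; lra.
Qed.

End quantile_coupling.

(** * The law of the walk *)

(** The default [true] is never read as long as [k] is at most the length of [s]. *)
Definition partial_sum (s : seq bool) (k : nat) : int :=
  \sum_(j < k) sign_step (nth true s j).

(** Replaces the recursion by a sum over times, the form of [time_nonneg]. *)
Lemma nonneg_stepsE x s : nonneg_steps x s =
  (\sum_(j < size s) ((0 <= x + partial_sum s j)%R &&
                      (0 <= x + partial_sum s j.+1)%R))%N.
Proof.
elim: s x => [|b s ih] x; first by rewrite big_ord0.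
rewrite big_ord_recl/= ih /partial_sum big_ord0 addr0 big_ord1/=; congr addn.
apply: eq_bigr => j _; rewrite [in RHS]big_ord_recl/= [in RHS]big_ord_recl/=.
by rewrite !addrA.
Qed.

Section walk_law.
Context {d : measure_display} {T : measurableType d} {R : realType}
  {P : probability T R}.
Variable eps : nat -> {RV P >-> R}.
Hypothesis iid : iid_rademacher eps.

Definition path_event (s : seq bool) : set T :=
  [set w | forall j, (j < size s)%N ->
           eps j w = (sign_step (nth true s j))%:~R].

Let path_eventE s : path_event s =
  \bigcap_(j in [set` seq_fset tt (iota 0 (size s))])
    (eps j @^-1` [set (sign_step (nth true s j))%:~R]).
Proof.
have memJ j : (j \in seq_fset tt (iota 0 (size s))) = (j < size s)%N.
  by rewrite seq_fsetE mem_iota.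
apply/seteqP; split => [w sw j js|w sw j js].
  by apply: sw; rewrite -memJ; exact: js.
by apply: sw; rewrite -memJ in js; exact: js.
Qed.

Lemma path_event_prob s : P (path_event s) = (2^-1 ^+ size s)%:E.
Proof.
have [indep half] := iid.
rewrite path_eventE.
rewrite (indep _ (fun j => [set (sign_step (nth true s j))%:~R])); last first.
  by move=> j; exact: measurable_set1.
rewrite (eq_bigr (fun=> (2^-1)%:E)); last first.
  by move=> j _; case: (half j) => h1 h2; case: (nth true s j).
rewrite prodEFin (perm_big _ (seq_fset_perm _ _)) undup_id ?iota_uniq//=.
by rewrite big_const_seq count_predT size_iota iter_mulr_1.
Qed.

Lemma measurable_path_event s : measurable (path_event s).
Proof.
by rewrite path_eventE; exact: fin_bigcap_measurable.
Qed.

Lemma walk_path_event s w k : path_event s w -> (k <= size s)%N ->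
  walk eps k w = (partial_sum s k)%:~R.
Proof.
move=> sw ks; rewrite /walk /partial_sum rmorph_sum/=.
by apply: eq_bigr => j _; apply: sw; exact: leq_trans ks.
Qed.

Lemma time_nonneg_path_event m s w : size s = (2 * m)%N -> path_event s w ->
  time_nonneg eps m w = (nonneg_steps 0 s)%:R.
Proof.
move=> sm sw; rewrite /time_nonneg big_add1/= big_mkord nonneg_stepsE sm natr_sum.
apply: eq_bigr => j _; rewrite /step_nonneg indicE; congr (_%:R).
have jm := ltn_ord j; rewrite !add0r.
have e1 := @walk_path_event s w j sw; have e2 := @walk_path_event s w j.+1 sw.
by congr nat_of_bool; apply/idP/andP; rewrite inE/= e1 ?e2 ?sm ?(ltnW jm)// !ler0z.
Qed.

(** The event contains the disjoint cylinders of the words with 2k nonnegative steps, each of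
    probability 4^-m. Only a lower bound is direct, since [eps] may take other values than 1 and -1
    on a null set. *)
Lemma relative_time_nonneg_mass m k : (0 < m)%N -> (k < m.+1)%N ->
  ((arcsine_weight m k)%:E <=
   P (relative_time_nonneg eps m @^-1` [set (k%:R / m%:R)%R]))%E.
Proof.
move=> m0; rewrite ltnS => km.
pose r := [seq s <- words (2 * m) | nonneg_steps 0 s == (2 * k)%N].
have rP s : s \in r -> size s = (2 * m)%N /\ nonneg_steps 0 s = (2 * k)%N.
  by rewrite mem_filter mem_words => /andP[/eqP -> /eqP ->].
have <- : P (\bigcup_(s in [set` r]) path_event s) = (arcsine_weight m k)%:E.
  rewrite measure_fin_bigcup; last 3 first.
  - exact: finite_seq.
  (* Words of equal length whose cylinders meet agree letter by letter. *)
  - move=> s t /= /rP[ss _] /rP[ts _] [w [sw tw]].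
    apply: (@eq_from_nth _ true); first by rewrite ss ts.
    move=> j js; have := sw j js; rewrite (tw j); last by rewrite ts -ss.
    move/intr_inj; by case: (nth _ _ _); case: (nth _ _ _).
  - by move=> s _; exact: measurable_path_event.
  rewrite -fsbig_seq; last by rewrite filter_uniq// words_uniq.
  rewrite (eq_big_seq (fun=> (2^-1 ^+ (2 * m))%:E)); last first.
    by move=> s /rP[ss _]; rewrite -ss; exact: path_event_prob.
  rewrite sumEFin; congr EFin; rewrite big_const_seq count_predT size_filter.
  rewrite -path_count_arcsine// iter_addr addr0.
  rewrite -[LHS]mulr_natl; congr (_ * _).
  by rewrite exprM exprVn -natrX exprVn.
rewrite le_measure ?inE//.
  apply: fin_bigcup_measurable => [|s _]; first exact: finite_seq.
  exact: measurable_path_event.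
move=> w [s /= /rP[ss st] sw]; rewrite /relative_time_nonneg.
rewrite (time_nonneg_path_event _ _ _ ss sw) st !natrM.
have : m%:R != 0 :> R by rewrite pnatr_eq0; lia.
by move=> ?; field.
Qed.

End walk_law.

(** * Lipschitz test functions and the Wasserstein bound *)

Lemma lipschitz1P {R : realType} (h : R -> R) :
  1.-lipschitz (h : R^o -> R^o) -> forall x y, `|h x - h y| <= `|x - y|.
Proof. by move=> hL x y; have := hL (x, y) (conj I I); rewrite /= mul1r. Qed.

Lemma lipschitz1_measurable {R : realType} (h : R -> R) :
  (forall x y, `|h x - h y| <= `|x - y|) -> measurable_fun setT h.
Proof.
move=> hL; apply: continuous_measurable_fun => x.
apply/cvgrPdist_le => e e0; near=> y.
apply: le_trans (hL _ _) _; near: y.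
by apply: cvgr_dist_le.
Unshelve. all: by end_near. Qed.

Lemma grid_inj {R : realType} m : (0 < m)%N ->
  {in gtn m.+1 &, injective (fun k : nat => k%:R / m%:R : R)}.
Proof.
move=> m0 i j _ _ /(mulIf _) ij; apply/eqP; rewrite -(eqr_nat R); apply/eqP/ij.
by rewrite invr_eq0 pnatr_eq0; lia.
Qed.

Section arcsine_coupling.
Context {R : realType}.
Variable h : R -> R.
Hypothesis hL : forall x y, `|h x - h y| <= `|x - y|.
Local Notation nu := (@arcsine_prob R).

Let mh : measurable_fun setT h. Proof. exact: lipschitz1_measurable. Qed.

Let N : set (measurableTypeR R) := ~` `]0, 1[.

Let mN : measurable N. Proof. exact: measurableC. Qed.

Let nuN : nu N = 0%E.
Proof.
rewrite /arcsine_prob; apply: integral0_eq => x /= /negP x01.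
by rewrite /arcsine_pdf indicE memNset ?mulr0//=; apply/negP.
Qed.

(** The arcsine law is carried by ]0, 1[, where |h| <= |h 0| + 1. *)
Lemma integrable_arcsine_lipschitz : nu.-integrable setT (fun x => (h x)%:E).
Proof.
apply/(negligible_integrable mN measurableT) => //.
  exact/measurable_EFinP.
rewrite setDE setCK setTI.
apply: (@le_integrable _ _ _ nu _ _ _ (cst (`|h 0| + 1)%:E)) => //.
- exact/measurable_EFinP/measurable_funTS.
- move=> x /=; rewrite in_itv/= => /andP[x0 x1].
  rewrite lee_fin [leRHS]ger0_norm ?addr_ge0//.
  have := hL x 0; rewrite subr0 (gtr0_norm x0) => hx.
  have := ler_normD (h 0) (h x - h 0); rewrite addrC subrK; lra.
- exact: finite_measure_integrable_cst.
Qed.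

Lemma integral_discretization_close m : (0 < m)%N ->
  (`| \int[nu]_x (h (discretization m x))%:E - \int[nu]_x (h x)%:E | <=
   (m%:R^-1)%:E)%E.
Proof.
move=> m0; have ih := integrable_arcsine_lipschitz.
have vI := @grid_inj R m m0.
have ihk := @integrable_finite_law _ _ R nu (discretization m) m.+1
   (fun k => k%:R / m%:R) (arcsine_weight m) h (measurable_discretization m) mh vI
   (discretization_mass m m0) (arcsine_cum_full m).
rewrite -integralB//.
have if_ := integrableB measurableT ihk ih.
rewrite (negligible_integral mN measurableT if_ nuN) setDE setCK setTI.
apply: le_trans (le_abse_integral _ _ _) _ => //.
  by apply: measurable_funTS; case/integrableP: if_.
apply: (@le_trans _ _ (\int[nu]_(x in `]0%R, 1%R[) cst (m%:R^-1)%:E x)%E).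
  apply: ge0_le_integral => //.
  - apply: measurableT_comp => //.
    by apply: measurable_funTS; case/integrableP: if_.
  - move=> x /=; rewrite in_itv/= => x01.
    rewrite lee_fin; apply: le_trans (hL _ _) _.
    exact: discretization_close.
rewrite integral_cst//= -[leRHS]mule1 lee_wpmul2l ?lee_fin ?invr_ge0//.
exact: probability_le1.
Qed.

(** Both variables have the same weights on the grid k/m, so both integrals are the same finite
    sum. *)
Lemma integral_relative_time_nonneg {d : measure_display} {T : measurableType d}
    {P : probability T R} (eps : nat -> {RV P >-> R}) (m : nat) :
  iid_rademacher eps -> (0 < m)%N ->
  (\int[distribution P (relative_time_nonneg eps m)]_x (h x)%:E =
   \int[nu]_x (h (discretization m x))%:E)%E.
Proof.
move=> iid m0.
have vI := @grid_inj R m m0.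
have mW : measurable_fun setT (relative_time_nonneg eps m : T -> R).
  exact: measurable_relative_time_nonneg.
have massW k := relative_time_nonneg_mass eps iid m k m0.
rewrite integral_distribution/=; last 2 first.
- exact/measurable_EFinP.
- exact: (@integrable_finite_law _ _ R P _ m.+1 _ _ h mW mh vI massW
    (arcsine_cum_full m)).
rewrite (@integral_finite_law _ _ R P _ m.+1 _ _ h mW mh vI massW (arcsine_cum_full m)).
by rewrite (@integral_finite_law _ _ R nu (discretization m) m.+1
   (fun k => k%:R / m%:R) (arcsine_weight m) h (measurable_discretization m) mh vI
   (discretization_mass m m0) (arcsine_cum_full m)).
Qed.

End arcsine_coupling.

Theorem theorem3p1 (R : realType) :
  exists C : R, 0 < C /\
    forall (d : measure_display) (T : measurableType d) (P : probability T R)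
      (eps : nat -> {RV P >-> R}), iid_rademacher eps ->
    forall m : nat, (0 < m)%N ->
      (wasserstein (distribution P (relative_time_nonneg eps m)) arcsine_prob
         <= (C / m%:R)%:E)%E.
Proof.
exists 1; split=> // d T P eps iid m m0.
apply: ge_ereal_sup => _ [h /lipschitz1P hL <-]; rewrite mul1r.
by rewrite integral_relative_time_nonneg//; exact: integral_discretization_close.
Qed.
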